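(* Let $P,Q\in\mathbb{C}[x,y]$ be relatively prime and $\mathcal{X}=P\frac{\partial}{\partial x}+Q\frac{\partial}{\partial y}$. Suppose a Puiseux series $y(x)$, either of the form $\sum_{l=0}^{\infty}b_l(x-x_0)^{(l_0+l)/n_0}$ near a point $x_0\in\mathbb{C}$ or of the form $\sum_{l=0}^{\infty}c_l x^{(l_0-l)/n_0}$ near $x=\infty$ (with $l_0\in\mathbb{Z}$, $n_0\in\mathbb{N}$), with uniquely determined coefficients, satisfies the equation $P(x,y)y_x-Q(x,y)=0$. Then there exists at most one irreducible invariant algebraic curve $F(x,y)$ of the vector field $\mathcal{X}$ (equivalently, of the system $x_t=P(x,y)$, $y_t=Q(x,y)$) such that this series is captured by $F(x,y)$, i.e. $F(x,y(x))=0$.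
   Context: A polynomial $F\in\mathbb{C}[x,y]\setminus\mathbb{C}$ is an invariant algebraic curve of $\mathcal{X}$ if $P F_x+Q F_y=\lambda F$ for some $\lambda\in\mathbb{C}[x,y]$. It is irreducible if $F$ is irreducible in $\mathbb{C}[x,y]$. Invariant algebraic curves $F$ and $cF$ with $c\in\mathbb{C}\setminus\{0\}$ are identified (one representative is taken from each such family). A Puiseux series satisfies $P(x,y)y_x-Q(x,y)=0$ if substituting it (with termwise differentiation) gives $0$ in the field of Puiseux series. ''With uniquely determined coefficients'' means that the coefficients contain no arbitrary constants (parameters), so $y(x)$ is one single fixed Puiseux series. *)

(* Defs.v *)
From HB Require Import structures.
From mathcomp Require Import all_boot all_order all_algebra.
From mathcomp Require Import boolp classical_sets functions fsbigop reals.
From mathcomp Require Import complex ring.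
Set Implicit Arguments.
Unset Strict Implicit.
Unset Printing Implicit Defensive.
Import Order.TTheory GRing.Theory Num.Theory.
Local Open Scope ring_scope.

(* A Puiseux series sum_q f(q) t^q in a local parameter t is the family f of
   its coefficients.  It is supported on exponents (l + k) / n, k a natural
   number, for one integer l and one n > 0: it is therefore of the form
   sum_(k >= 0) b_k t^((l + k) / n).  The series are formal: no convergence is
   required. *)
Definition supported (K : fieldType) (n : nat) (l : int) (f : rat -> K) :=
  forall q : rat, f q != 0 -> exists k : nat, q = (l%:~R + k%:R) / n%:R.

Definition is_puiseux (K : fieldType) (f : rat -> K) :=
  exists (n : nat) (l : int), (0 < n)%N /\ supported n l f.

Record puiseux (K : fieldType) := Puiseux {
  pcoef : rat -> K;
  _ : is_puiseux pcoef }.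

HB.instance Definition _ (K : fieldType) := gen_eqMixin (puiseux K).
HB.instance Definition _ (K : fieldType) := gen_choiceMixin (puiseux K).

Section PuiseuxRing.
Variable K : fieldType.
Implicit Types (f g h : rat -> K) (x y z : puiseux K) (n m k : nat) (l : int).

Lemma puiseuxP x : is_puiseux (pcoef x). Proof. by case: x. Qed.

Lemma pcoef_inj : injective (@pcoef K).
Proof.
case=> f Hf [g Hg] /= E; move: Hf Hg; rewrite E => Hf Hg.
by congr Puiseux; exact: Prop_irrelevance.
Qed.

Lemma supported_ramif n m l f : (0 < n)%N -> (0 < m)%N ->
  supported n l f -> supported (n * m) (l * m%:Z) f.
Proof.
move=> n0 m0 H q /H [k ->]; exists (k * m)%N.
rewrite intrM !natrM pmulrn -mulrDl -mulf_div divff ?mulr1 //.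
by rewrite intr_eq0 -lt0n.
Qed.

Lemma supported_shift n l l' f : l' <= l -> supported n l f -> supported n l' f.
Proof.
move=> ll H q /H [k ->]; exists (`|l - l'|%N + k)%N.
rewrite natrD addrA; congr ((_ + _) / _).
have -> : `|l - l'|%:R = (l - l')%:~R :> rat.
  by rewrite pmulrn gez0_abs // subr_ge0.
by rewrite intrB addrCA subrr addr0.
Qed.

Lemma common_support f g : is_puiseux f -> is_puiseux g ->
  exists n l, (0 < n)%N /\ supported n l f /\ supported n l g.
Proof.
move=> [n [l [n0 Hf]]] [m [l' [m0 Hg]]].
exists (n * m)%N, (Num.min (l * m%:Z) (l' * n%:Z)); rewrite muln_gt0 n0 m0.
split=> //; split.
  by apply/supported_shift/(supported_ramif n0 m0 Hf); rewrite ge_min lexx.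
apply/(@supported_shift _ (l' * n%:Z)); first by rewrite ge_min lexx orbT.
by rewrite mulnC; apply: supported_ramif.
Qed.

Lemma common_support3 f g h : is_puiseux f -> is_puiseux g -> is_puiseux h ->
  exists n l, (0 < n)%N /\ supported n l f /\ supported n l g /\ supported n l h.
Proof.
move=> Hf Hg [m [l' [m0 Hh]]]; have [n [l [n0 [Sf Sg]]]] := common_support Hf Hg.
exists (n * m)%N, (Num.min (l * m%:Z) (l' * n%:Z)); rewrite muln_gt0 n0 m0.
have E : Num.min (l * m%:Z) (l' * n%:Z) <= l * m%:Z by rewrite ge_min lexx.
split=> //; split; first by apply/(supported_shift E)/supported_ramif.
split; first by apply/(supported_shift E)/supported_ramif.
apply/(@supported_shift _ (l' * n%:Z)); first by rewrite ge_min lexx orbT.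
by rewrite mulnC; apply: supported_ramif.
Qed.

Lemma supported_ext n l f g : supported n l f -> supported n l g ->
  (forall k, f ((l%:~R + k%:R) / n%:R) = g ((l%:~R + k%:R) / n%:R)) -> f = g.
Proof.
move=> Hf Hg E; apply/funext => q.
have [f0|/Hf [k ->]] := eqVneq (f q) 0; last exact: E.
have [g0|/Hg [k ->]] := eqVneq (g q) 0; last exact: E.
by rewrite f0 g0.
Qed.

Definition mono_coef (c : K) (q : rat) : rat -> K :=
  fun r => if r == q then c else 0.

Lemma mono_puiseux c q : is_puiseux (mono_coef c q).
Proof.
exists `|denq q|%N, (numq q); split; first by rewrite absz_gt0 denq_eq0.
move=> r; rewrite /mono_coef; case: (r =P q) => [-> _|]; last by rewrite eqxx.
exists 0%N; rewrite addr0 -{1}[q]divq_num_den; congr (_ / _).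
by rewrite pmulrn gez0_abs // ltW.
Qed.

(* c t^q *)
Definition pmono c q : puiseux K := Puiseux (mono_puiseux c q).

Definition add_coef f g : rat -> K := fun q => f q + g q.
Definition opp_coef f : rat -> K := fun q => - f q.

(* The Cauchy product.  For Puiseux series only finitely many terms are
   nonzero, so this finite-support sum does not fall back on its default. *)
Definition mul_coef f g : rat -> K :=
  fun q => \sum_(a \in [set: rat]%classic) f a * g (q - a).

Lemma supported_add n l f g :
  supported n l f -> supported n l g -> supported n l (add_coef f g).
Proof.
move=> Hf Hg q; rewrite /add_coef.
have [->|/Hf //] := eqVneq (f q) 0; rewrite add0r; exact: Hg.
Qed.

Lemma supported_opp n l f : supported n l f -> supported n l (opp_coef f).
Proof. by move=> Hf q; rewrite /opp_coef oppr_eq0; apply: Hf. Qed.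

Lemma add_puiseux x y : is_puiseux (add_coef (pcoef x) (pcoef y)).
Proof.
have [n [l [n0 [Hx Hy]]]] := common_support (puiseuxP x) (puiseuxP y).
by exists n, l; split=> //; apply: supported_add.
Qed.

Lemma opp_puiseux x : is_puiseux (opp_coef (pcoef x)).
Proof.
have [n [l [n0 Hx]]] := puiseuxP x.
by exists n, l; split=> //; apply: supported_opp.
Qed.

Lemma supported_mul n l l' f g : (0 < n)%N -> supported n l f ->
  supported n l' g -> supported n (l + l') (mul_coef f g).
Proof.
move=> n0 Hf Hg q; apply: contraNP => Hq; rewrite /mul_coef fsbig1 //= => a _.
apply/eqP; rewrite mulf_eq0; apply/orP.
have [|/Hf [i Ei]] := eqVneq (f a) 0; first by left.
have [|/Hg [j Ej]] := eqVneq (g (q - a)) 0; first by right.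
case: Hq; exists (i + j)%N.
by rewrite -[LHS](subrK a) Ej Ei -mulrDl intrD natrD addrC addrACA.
Qed.

Lemma mul_coefE n l l' f g k : (0 < n)%N -> supported n l f ->
  supported n l' g ->
  mul_coef f g (((l + l')%:~R + k%:R) / n%:R) =
  \sum_(i < k.+1) f ((l%:~R + i%:R) / n%:R) *
                  g ((l'%:~R + (k - i)%:R) / n%:R).
Proof.
move=> n0 Hf Hg; have nn0 : n%:R != 0 :> rat by rewrite pnatr_eq0 -lt0n.
pose e i : rat := (l%:~R + i%:R) / n%:R.
have e_inj : injective e.
  by move=> i j /(mulIf (invr_neq0 nn0)) /addrI /eqP; rewrite eqr_nat => /eqP.
rewrite /mul_coef (@fsbigE _ _ _ _ _ [seq e i | i <- iota 0 k.+1]) //.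
- rewrite big_map big_mkcond -[iota _ _]/(index_iota 0 k.+1) big_mkord.
  apply: eq_bigr => i _; rewrite in_setT /e.
  congr (f _ * g _); rewrite -mulrBl natrB -1?ltnS //; congr (_ / _).
  by rewrite intrD; ring.
- by rewrite map_inj_uniq // iota_uniq.
move=> a _ Ha; apply/eqP; rewrite mulf_eq0; apply/orP.
have [|/Hf [i Ei]] := eqVneq (f a) 0; first by left.
right; apply: contraNT Ha => /Hg [j Ej].
apply/mapP; exists i => //; rewrite mem_iota add0n /= ltnS.
have : (l + l')%:~R + k%:R = (l%:~R + i%:R) + (l'%:~R + j%:R) :> rat.
  apply: (mulIf (invr_neq0 nn0)); rewrite [RHS]mulrDl -Ej -Ei.
  by rewrite [RHS]addrC subrK.
rewrite intrD addrACA => /addrI; rewrite -natrD => /eqP.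
by rewrite eqr_nat => /eqP ->; rewrite leq_addr.
Qed.

Lemma mul_puiseux x y : is_puiseux (mul_coef (pcoef x) (pcoef y)).
Proof.
have [n [l [n0 [Hx Hy]]]] := common_support (puiseuxP x) (puiseuxP y).
by exists n, (l + l); split=> //; apply: supported_mul.
Qed.

Definition padd x y := Puiseux (add_puiseux x y).
Definition popp x := Puiseux (opp_puiseux x).
Definition pmul x y := Puiseux (mul_puiseux x y).

Lemma paddA : associative padd.
Proof. by move=> x y z; apply/pcoef_inj/funext => q; apply: addrA. Qed.
Lemma paddC : commutative padd.
Proof. by move=> x y; apply/pcoef_inj/funext => q; apply: addrC. Qed.
Lemma padd0 : left_id (pmono 0 0) padd.
Proof.
move=> x; apply/pcoef_inj/funext => q /=.
by rewrite /add_coef /mono_coef if_same add0r.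
Qed.
Lemma paddN : left_inverse (pmono 0 0) popp padd.
Proof.
move=> x; apply/pcoef_inj/funext => q /=.
by rewrite /add_coef /opp_coef /mono_coef if_same addNr.
Qed.

HB.instance Definition _ := GRing.isZmodule.Build (puiseux K)
  paddA paddC padd0 paddN.

Let trunc (a : nat -> K) k : {poly K} := \poly_(i < k.+1) a i.

Let truncM (a b : nat -> K) k j : (j <= k)%N ->
  (trunc a k * trunc b k)`_j = \sum_(i < j.+1) a i * b (j - i)%N.
Proof.
move=> jk; rewrite coefM; apply: eq_bigr => i _; rewrite !coef_poly !ltnS.
have ij : (i <= j)%N by rewrite -ltnS.
by rewrite (leq_trans ij jk) (leq_trans (leq_subr i j) jk).
Qed.

Let cauchyA (a b c : nat -> K) k :
  \sum_(i < k.+1) a i * (\sum_(j < (k - i).+1) b j * c (k - i - j)%N) =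
  \sum_(i < k.+1) (\sum_(j < i.+1) a j * b (i - j)%N) * c (k - i)%N.
Proof.
transitivity ((trunc a k * (trunc b k * trunc c k))`_k).
  rewrite coefM; apply: eq_bigr => i _; rewrite truncM ?leq_subr //.
  by rewrite coef_poly ltn_ord.
rewrite mulrA coefM; apply: eq_bigr => i _.
by rewrite truncM -1?ltnS // coef_poly ltnS leq_subr.
Qed.

Lemma pmulA : associative pmul.
Proof.
move=> x y z; apply: pcoef_inj => /=.
have [n [l [n0 [Hx [Hy Hz]]]]] :=
  common_support3 (puiseuxP x) (puiseuxP y) (puiseuxP z).
have Hxy := supported_mul n0 Hx Hy; have Hyz := supported_mul n0 Hy Hz.
apply: (@supported_ext n (l + (l + l))); first exact: supported_mul.
  by rewrite addrA; apply: supported_mul.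
move=> k; rewrite (mul_coefE _ n0 Hx Hyz) addrA (mul_coefE _ n0 Hxy Hz).
under eq_bigr => i _ do rewrite (mul_coefE _ n0 Hy Hz).
under [RHS]eq_bigr => i _ do rewrite (mul_coefE _ n0 Hx Hy).
exact: (cauchyA (fun i => pcoef x ((l%:~R + i%:R) / n%:R))
                (fun i => pcoef y ((l%:~R + i%:R) / n%:R))
                (fun i => pcoef z ((l%:~R + i%:R) / n%:R))).
Qed.

Lemma pmulC : commutative pmul.
Proof.
move=> x y; apply: pcoef_inj => /=.
have [n [l [n0 [Hx Hy]]]] := common_support (puiseuxP x) (puiseuxP y).
apply: (@supported_ext n (l + l)); try exact: supported_mul.
move=> k; rewrite (mul_coefE _ n0 Hx Hy) (mul_coefE _ n0 Hy Hx).
rewrite (reindex_inj rev_ord_inj) /=; apply: eq_bigr => i _.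
by rewrite subSS mulrC subKn // -ltnS.
Qed.

Lemma pcoefMmono c q x r : pcoef (pmul (pmono c q) x) r = c * pcoef x (r - q).
Proof.
rewrite /= /mul_coef (@fsbigE _ _ _ _ _ [:: q]) //=.
  by rewrite big_mkcond big_seq1 in_setT /mono_coef eqxx.
by move=> a _; rewrite inE /mono_coef => /negPf ->; rewrite mul0r.
Qed.

Lemma pmul1 : left_id (pmono 1 0) pmul.
Proof.
by move=> x; apply/pcoef_inj/funext => q; rewrite pcoefMmono mul1r subr0.
Qed.

Lemma pmulDl : left_distributive pmul padd.
Proof.
move=> x y z; apply: pcoef_inj => /=.
have [n [l [n0 [Hx [Hy Hz]]]]] :=
  common_support3 (puiseuxP x) (puiseuxP y) (puiseuxP z).
have Hxy := supported_add Hx Hy.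
apply: (@supported_ext n (l + l)); first exact: supported_mul.
  by apply: supported_add; apply: supported_mul.
move=> k; rewrite /add_coef (mul_coefE _ n0 Hxy Hz) (mul_coefE _ n0 Hx Hz).
rewrite (mul_coefE _ n0 Hy Hz) -big_split /=.
by apply: eq_bigr => i _; rewrite -mulrDl.
Qed.

Lemma pone_neq0 : pmono 1 0 != 0.
Proof.
apply/eqP => /(congr1 (fun x => pcoef x 0)) /= /eqP.
by rewrite /mono_coef eqxx oner_eq0.
Qed.

HB.instance Definition _ := GRing.Zmodule_isComNzRing.Build (puiseux K)
  pmulA pmulC pmul1 pmulDl pone_neq0.

End PuiseuxRing.

(* The point near which a series is expanded. *)
Inductive place (K : fieldType) := Finite of K | Infinity.
Arguments Infinity {K}.

Section Substitution.
Variable K : fieldType.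

(* The local parameter t is x - x0 at x0 and 1/x at infinity.  Thus an element
   of puiseux K reads as sum_(k >= 0) b_k (x - x0)^((l + k) / n) at x0 and as
   sum_(k >= 0) b_k x^((- l - k) / n) at infinity. *)
Definition xat (s : place K) : puiseux K :=
  match s with
  | Finite x0 => pmono x0 0 + pmono 1 1
  | Infinity => pmono 1 (-1)
  end.

(* Coefficients of the termwise derivative with respect to x: the term b t^q
   has derivative q b t^(q - 1) at a finite point, and, being b x^(- q),
   derivative - q b x^(- q - 1) = - q b t^(q + 1) at infinity.  The embedding
   ratr of the exponents is meaningful for K of characteristic 0. *)
Definition deriv_coef (s : place K) (f : rat -> K) : rat -> K :=
  match s with
  | Finite _ => fun q => ratr (q + 1) * f (q + 1)
  | Infinity => fun q => - (ratr (q - 1) * f (q - 1))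
  end.

Lemma deriv_puiseux (s : place K) (y : puiseux K) :
  is_puiseux (deriv_coef s (pcoef y)).
Proof.
have [n [l [n0 Hy]]] := puiseuxP y.
have nn0 : n%:R != 0 :> rat by rewrite pnatr_eq0 -lt0n.
case: s => [x0|].
  exists n, (l - n%:Z); split=> // q /=.
  rewrite mulf_eq0 negb_or => /andP[_ /Hy [k E]]; exists k.
  by rewrite -[q](addrK 1) E intrB -pmulrn addrAC mulrBl divff.
exists n, (l + n%:Z); split=> // q /=.
rewrite oppr_eq0 mulf_eq0 negb_or => /andP[_ /Hy [k E]]; exists k.
by rewrite -[q](subrK 1) E intrD -pmulrn addrAC [RHS]mulrDl divff.
Qed.

Definition pderiv (s : place K) (y : puiseux K) : puiseux K :=
  Puiseux (deriv_puiseux s y).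

(* K[x,y] is {poly {poly K}}; the outer variable is y and the inner one x. *)
Definition dx (F : {poly {poly K}}) : {poly {poly K}} :=
  map_poly (fun p : {poly K} => p^`()) F.
Definition dy (F : {poly {poly K}}) : {poly {poly K}} := F^`().

(* F(x, y(x)) *)
Definition subst (s : place K) (y : puiseux K) (F : {poly {poly K}}) :
    puiseux K :=
  (map_poly (fun p : {poly K} =>
     (map_poly (fun c : K => pmono c 0) p).[xat s]) F).[y].

Definition relatively_prime (P Q : {poly {poly K}}) :=
  forall D A B : {poly {poly K}}, P = D * A -> Q = D * B ->
    D \is a GRing.unit.

(* Irreducibility in the ring K[x,y]; polydiv's irreducible_poly, meant for
   coefficients in a field, is a different notion over K[x]. *)
Definition irreducible_curve (F : {poly {poly K}}) :=
  [/\ F != 0, F \isn't a GRing.unit &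
      forall A B : {poly {poly K}}, F = A * B ->
        A \is a GRing.unit \/ B \is a GRing.unit].

Definition invariant_curve (P Q F : {poly {poly K}}) :=
  (forall c : K, F != c%:P%:P) /\
  exists L : {poly {poly K}}, P * dx F + Q * dy F = L * F.

Definition satisfies_ode (P Q : {poly {poly K}}) (s : place K)
    (y : puiseux K) :=
  subst s y P * pderiv s y - subst s y Q = 0.

Definition captured (s : place K) (y : puiseux K) (F : {poly {poly K}}) :=
  subst s y F = 0.

End Substitution.

(* Main.v *)
Require Import Defs.
From mathcomp Require Import all_boot all_order all_algebra.
From mathcomp Require Import reals complex.
Import GRing.Theory.
Import Num.Theory.
Local Open Scope ring_scope.
From HB Require Import structures.
Set Implicit Arguments.
Unset Strict Implicit.

(** The irreducible polynomials vanishing at a Puiseux series y(x) are all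
proportional, as for the minimal polynomial of an algebraic element: the
polynomials killed by y = y(x) form an ideal of K[x,y] that meets K[x] only in
0, and F and G both generate it.  Indeed substitution of y(x) for y is a ring
morphism from K[x,y] to the Puiseux series ([subst_is_ring_morphism]), and it
is injective on K[x], because x is transcendental over K in the Puiseux series
([horner_xat_eq0]).

If irreducible F and G are both captured, their resultant with respect to y is
a polynomial in x that lies in the ideal (F, G), so it is killed by the
substitution, hence it is 0: F and G have a common factor D of positive degree
in y over K(x).  Gauss's lemma ([gauss_factorization]) brings this factor back
to K[x,y]: D is a multiple of F by irreducibility of F, so that F divides G
over K(x), hence in K[x,y], and irreducibility of G makes the quotient a
constant.

Gauss's lemma is obtained over an algebraically closed field, where the primes
of K[x] are the x - r: a denominator is cleared one root at a time, since
evaluation at x = r has the integral domain K[y] as target. *)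

(** * Substitution of a Puiseux series *)

(** The coefficient embedding of the substitution, named so that it can carry
its ring morphism structure. *)
Definition pconst (K : fieldType) (c : K) : puiseux K := pmono c 0.

Lemma pconst_is_zmod_morphism (K : fieldType) : zmod_morphism (@pconst K).
Proof.
move=> a b; apply/pcoef_inj/boolp.funext => q /=.
by rewrite /add_coef /opp_coef /mono_coef; case: ifP => // _; rewrite subr0.
Qed.

Lemma pmonoM (K : fieldType) (a b : K) p q :
  pmono a p * pmono b q = pmono (a * b) (p + q).
Proof.
apply/pcoef_inj/boolp.funext => r; rewrite [LHS]pcoefMmono /= /mono_coef.
by rewrite subr_eq addrC; case: ifP => // _; rewrite mulr0.
Qed.

Lemma pconst_is_monoid_morphism (K : fieldType) : monoid_morphism (@pconst K).
Proof. by split=> // a b; rewrite /pconst pmonoM addr0. Qed.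

HB.instance Definition _ (K : fieldType) :=
  GRing.isZmodMorphism.Build K (puiseux K) (@pconst K)
    (@pconst_is_zmod_morphism K).
HB.instance Definition _ (K : fieldType) :=
  GRing.isMonoidMorphism.Build K (puiseux K) (@pconst K)
    (@pconst_is_monoid_morphism K).

Lemma pcoef_sum (K : fieldType) n (x : 'I_n -> puiseux K) q :
  pcoef (\sum_(i < n) x i) q = \sum_(i < n) pcoef (x i) q.
Proof.
by elim/big_rec2: _ => [|i a z _ <-] //; rewrite /= /mono_coef if_same.
Qed.

Lemma pmonoX (K : fieldType) (e : rat) n :
  pmono 1 e ^+ n = pmono 1 (e *+ n) :> puiseux K.
Proof. by elim: n => // n IH; rewrite exprS IH pmonoM mul1r mulrS. Qed.

(** The powers of t^e have pairwise distinct exponents when e is nonzero, so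
the coefficients of a polynomial in t^e are read off the series. *)
Lemma horner_pmono_eq0 (K : fieldType) (e : rat) (p : {poly K}) : e != 0 ->
  (map_poly (@pconst K) p).[pmono 1 e] = 0 -> p = 0.
Proof.
move=> e0 p0; apply/polyP => k; rewrite coef0.
have [ltkp|/leq_sizeP->//] := ltnP k (size p).
have term i :
    (map_poly (@pconst K) p)`_i * pmono 1 e ^+ i = pmono p`_i (e *+ i).
  by rewrite coef_map pmonoX pmonoM mulr1 add0r.
have := congr1 (fun z => pcoef z (e *+ k)) p0.
rewrite horner_coef size_map_inj_poly ?raddf0 //; last exact: fmorph_inj.
under eq_bigr => i _ do rewrite term.
rewrite pcoef_sum (bigD1 (Ordinal ltkp)) //= big1 => [|i ik].
  by rewrite /mono_coef eqxx if_same addr0.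
rewrite /mono_coef -![e *+ _]mulr_natr (inj_eq (mulfI e0)) eqr_nat.
by rewrite ifN // eq_sym; apply: contra ik => /eqP ik; apply/eqP/val_inj.
Qed.

(** The element x is transcendental over the constants: at a finite place, a
translation of the variable makes it the local parameter itself. *)
Lemma horner_xat_eq0 (K : fieldType) (s : place K) (p : {poly K}) :
  (map_poly (@pconst K) p).[xat s] = 0 -> p = 0.
Proof.
case: s => [x0|] /=; last exact: horner_pmono_eq0.
have -> : pmono x0 0 + pmono 1 1 =
    (map_poly (@pconst K) ('X + x0%:P)).[pmono 1 1].
  by rewrite rmorphD /= map_polyX map_polyC !hornerE addrC.
rewrite -horner_comp -map_comp_poly => /horner_pmono_eq0 p0.
by apply/eqP; rewrite -(comp_poly2_eq0 p (size_XaddC x0)) p0.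
Qed.

(** Evaluation of the coefficients at x, then of the polynomial at y(x): a
composite of ring morphisms whose target is commutative. *)
Lemma subst_is_ring_morphism (K : fieldType) (s : place K) (y : puiseux K) :
  exists phi : {rmorphism {poly {poly K}} -> puiseux K},
    (forall F, phi F = subst s y F) /\
    (forall p : {poly K}, phi p%:P = (map_poly (@pconst K) p).[xat s]).
Proof.
have cx : commr_rmorph (@pconst K) (xat s) by move=> c; exact: mulrC.
have cy : commr_rmorph (horner_morph cx) y by move=> p; exact: mulrC.
exists (horner_morph cy); split=> // p.
by rewrite /= horner_morphC.
Qed.

(** * Gauss's lemma *)

Lemma map_horner_eval_eq0 (K : fieldType) (r : K) (A : {poly {poly K}}) :
  map_poly (horner_eval r) A = 0 -> exists A1, A = ('X - r%:P) *: A1.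
Proof.
move=> A0; exists (map_poly (fun p => p %/ ('X - r%:P)) A).
apply/polyP => i; rewrite coefZ coef_map_id0 ?div0p // mulrC divpK //.
rewrite dvdp_XsubCl; apply/rootP.
by have := congr1 (fun q : {poly K} => q`_i) A0; rewrite coef_map coef0.
Qed.

(** A factorization of F over K(x) comes from a factorization in K[x,y].  Each
root r of the denominator a makes x - r divide A * B, hence A or B. *)
Lemma gauss_factorization (K : closedFieldType) (a : {poly K})
    (F A B : {poly {poly K}}) : a != 0 -> a *: F = A * B ->
  exists u v A' B', [/\ F = A' * B', A = u *: A' & B = v *: B'].
Proof.
have [n] := ubnP (size a); elim: n => // n IH in a A B * => an a0 E.
have [a1|/closed_rootP[r /factor_theorem[b Eb]]] := boolP (size a == 1%N).
  have ua : a \is a GRing.unit.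
    have /size_poly1P[c c0 ->] := a1.
    by rewrite poly_unitE size_polyC c0 coefC unitfE.
  exists a, 1, (a^-1 *: A), B; rewrite scale1r scalerA divrr // scale1r.
  by split=> //; rewrite -scalerAl -E scalerA mulVr ?scale1r.
have lI : injective (fun U : {poly {poly K}} => ('X - r%:P) *: U).
  move=> U V; rewrite -!mul_polyC; apply: mulfI.
  by rewrite polyC_eq0 polyXsubC_eq0.
have b0 : b != 0 by apply: contraNneq a0 => b0; rewrite Eb b0 mul0r.
have bn : (size b < n)%N.
  by move: an; rewrite Eb size_Mmonic ?monicXsubC // size_XsubC addn2.
have : map_poly (horner_eval r) A * map_poly (horner_eval r) B == 0.
  rewrite -rmorphM -E Eb; apply/eqP/polyP => i.
  by rewrite coef_map coefZ coef0 /= /horner_eval !hornerE subrr mulr0 mul0r.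
rewrite mulf_eq0 => /orP[] /eqP /map_horner_eval_eq0[C EC].
- have /(IH b C B bn b0)[u [v [A' [B' [EF ECu EB]]]]] : b *: F = C * B.
    apply: lI.
    by rewrite scalerA mulrC -Eb E EC scalerAl.
  by exists (('X - r%:P) * u), v, A', B'; rewrite EC ECu scalerA.
- have /(IH b A C bn b0)[u [v [A' [B' [EF EA ECv]]]]] : b *: F = A * C.
    apply: lI.
    by rewrite scalerA mulrC -Eb E EC scalerAr.
  by exists u, (('X - r%:P) * v), A', B'; rewrite EC ECv scalerA.
Qed.

Lemma size_unit_curve (K : fieldType) (U : {poly {poly K}}) :
  U \is a GRing.unit -> size U = 1%N.
Proof. by rewrite poly_unitE => /andP[/eqP]. Qed.

Lemma unit_curveP (K : fieldType) (U : {poly {poly K}}) :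
  U \is a GRing.unit -> exists2 c : K, c != 0 & U = c%:P%:P.
Proof.
rewrite poly_unitE => /andP[/size_poly1P[p _ ->]]; rewrite coefC /=.
by rewrite poly_unitE => /andP[/size_poly1P[c c0 ->] _]; exists c.
Qed.

(** The factor D may contain a polynomial in x that F does not have; up to that
content D is a factor of F in K[x,y] itself, and the cofactor, not D, must be
the unit because D involves y. *)
Lemma irreducible_curve_factor (K : closedFieldType) (a : {poly K})
    (F A D : {poly {poly K}}) : irreducible_curve F -> a != 0 ->
  (1 < size D)%N -> a *: F = A * D -> exists C, D = C * F.
Proof.
move=> [_ _ irrF] a0 sD E.
have [u [v [A' [D' [EF _ ED]]]]] := gauss_factorization a0 E.
have [uA|/size_unit_curve sD'] := irrF _ _ EF; last first.
  by move: sD; rewrite ED ltnNge (leq_trans (size_scale_leq _ _)) // sD'.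
by exists (v *: A'^-1); rewrite EF -scalerAl mulrA mulVr // mul1r.
Qed.

(** Since F involves y and is irreducible, it has no content in K[x], so the
denominator a has to cancel against C. *)
Lemma irreducible_curve_dvd (K : closedFieldType) (a : {poly K})
    (F G C : {poly {poly K}}) : irreducible_curve F -> (1 < size F)%N ->
  a != 0 -> a *: G = C * F -> exists C', G = C' * F.
Proof.
move=> [_ _ irrF] sF a0 E.
have [u [v [C' [F' [EG _ EF]]]]] := gauss_factorization a0 E.
have EvF : F = v%:P * F' by rewrite mul_polyC.
have [uv|/size_unit_curve sF'] := irrF _ _ EvF.
  by exists (C' * v%:P^-1); rewrite EG EF -mul_polyC -mulrA mulKr.
by move: sF; rewrite EF ltnNge (leq_trans (size_scale_leq _ _)) // sF'.
Qed.

(** * Captured irreducible curves *)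

Lemma captured_size_gt1 (K : fieldType) (s : place K) (y : puiseux K) F :
  F != 0 -> captured s y F -> (1 < size F)%N.
Proof.
move=> F0 cF; rewrite ltnNge; apply: contra F0 => /size1_polyC EF.
have [phi [phiE phiC]] := subst_is_ring_morphism s y.
move: cF; rewrite /captured -phiE EF phiC => /horner_xat_eq0 ->.
by rewrite polyC0.
Qed.

Lemma captured_size_gcdp (K : fieldType) (s : place K) (y : puiseux K) F G :
  F != 0 -> G != 0 -> captured s y F -> captured s y G ->
  (1 < size (gcdp F G))%N.
Proof.
move=> F0 G0 cF cG; have [phi [phiE phiC]] := subst_is_ring_morphism s y.
have [[U V] _ /= EUV] := resultant_in_ideal (captured_size_gt1 F0 cF)
  (captured_size_gt1 G0 cG).
rewrite -resultant_eq0; apply/eqP/(horner_xat_eq0 (s := s)).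
by rewrite -phiC EUV rmorphD !rmorphM /= !phiE cF cG !mulr0 addr0.
Qed.

Lemma captured_irreducible_unique (K : closedFieldType) (s : place K)
    (y : puiseux K) (F G : {poly {poly K}}) :
  irreducible_curve F -> captured s y F ->
  irreducible_curve G -> captured s y G ->
  exists2 c : K, c != 0 & G = c%:P%:P * F.
Proof.
move=> iF cF iG cG; have [F0 nuF _] := iF; have [G0 _ irrG] := iG.
have sD := captured_size_gcdp F0 G0 cF cG.
have /Pdiv.Idomain.dvdpP[[a A] /= a0 EF] := Pdiv.Idomain.dvdp_gcdl F G.
have /Pdiv.Idomain.dvdpP[[b B] /= b0 EG] := Pdiv.Idomain.dvdp_gcdr F G.
have [C ED] := irreducible_curve_factor iF a0 sD EF.
rewrite ED mulrA in EG.
have [C' EG'] := irreducible_curve_dvd iF (captured_size_gt1 F0 cF) b0 EG.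
have [/unit_curveP[c c0 EC]|uF] := irrG _ _ EG'; last by rewrite uF in nuF.
by exists c => //; rewrite EG' EC.
Qed.

Theorem theorem2p3 (R : realType) (P Q : {poly {poly R[i]}})
    (s : place R[i]) (y : puiseux R[i]) :
  relatively_prime P Q ->
  satisfies_ode P Q s y ->
  forall F G : {poly {poly R[i]}},
    invariant_curve P Q F -> irreducible_curve F -> captured s y F ->
    invariant_curve P Q G -> irreducible_curve G -> captured s y G ->
    exists2 c : R[i], c != 0 & G = c%:P%:P * F.
Proof.
move=> _ _ F G _ iF cF _ iG cG.
exact: (captured_irreducible_unique iF cF iG cG).
Qed.
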